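(* Fix an integer $m\ge 2$. The dynamic program which computes, for $k=n,n-1,\dots,1$ successively, the values $\Psi_{m,n}^{i}(k)$ ($1\le i\le m$) by the recurrences listed in the context has computational complexity $O(n)$; that is, the number of elementary operations (arithmetic operations and comparisons of two numbers) needed is $O(n)$ as $n\to\infty$.
   Context: Multi-returning secretary problem: there are $n$ candidates with a strict total ranking, each having $m$ identical copies; the $mn$ objects are inspected one by one in uniformly random order, each being immediately and irrevocably accepted (ending the process) or rejected, knowing only the identities and relative ranks of the candidates inspected so far. Success means accepting a copy of the best candidate. For $1\le k\le n$, $1\le i\le m$, $\Psi_{m,n}^{i}(k)$ is the probability of success under optimal play from a moment at which all inspected objects have been rejected, exactly $k$ different candidates have been inspected, and exactly $i$ copies of the best one among these $k$ have been inspected. In particular $\Psi_{m,n}^1(1)$ is the optimal probability of success. The dynamic program is given by the terminal values $\Psi_{m,n}^{m}(n)=0$ and $\Psi_{m,n}^{i}(n)=1$ for $1\le i\le m-1$, and, for $1\le k<n$, the recurrences $$\Psi_{m,n}^{m}(k)=\frac{k}{k+1}\Psi_{m,n}^{m}(k+1)+\frac{1}{k+1}\Psi_{m,n}^{1}(k+1),$$ $$\Psi_{m,n}^{m-1}(k)=\frac{1}{mn-mk+1}\max\left\{\frac{k}{n},\Psi_{m,n}^{m}(k)\right\}+\frac{k(mn-mk)}{(k+1)(mn-mk+1)}\Psi_{m,n}^{m-1}(k+1)+\frac{mn-mk}{(k+1)(mn-mk+1)}\Psi_{m,n}^{1}(k+1),$$ and, for $1\le i\le m-2$ (taken in decreasing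 order of $i$), $$\Psi_{m,n}^{i}(k)=\frac{k(mn-mk)}{(k+1)(mn-mk+m-i)}\Psi_{m,n}^{i}(k+1)+\frac{m-i}{mn-mk+m-i}\Psi_{m,n}^{i+1}(k)+\frac{mn-mk}{(k+1)(mn-mk+m-i)}\Psi_{m,n}^{1}(k+1).$$ *)

(* Defs.v *)
From mathcomp Require Import all_boot all_order all_algebra.
From mathcomp Require Import all_classical all_reals all_analysis.

Set Implicit Arguments.
Unset Strict Implicit.
Unset Printing Implicit Defensive.

Import Order.TTheory GRing.Theory Num.Theory.
Import numFieldNormedType.Exports.

Local Open Scope ring_scope.

(* The recurrences of the multi-returning secretary problem; [Psi i k] is
   Psi_{m,n}^i(k).  They are imposed on the range 1 <= i <= m, 1 <= k <= n
   only, where they determine Psi. *)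
Definition secretary_recurrences (R : realType) (m n : nat)
    (Psi : nat -> nat -> R) : Prop :=
  [/\ Psi m n = 0 /\
        (forall i : nat, (1 <= i <= m - 1)%N -> Psi i n = 1),
      forall k : nat, (1 <= k < n)%N ->
        Psi m k = k%:R / (k%:R + 1) * Psi m k.+1
                  + 1 / (k%:R + 1) * Psi 1%N k.+1,
      forall k : nat, (1 <= k < n)%N ->
        let d := m%:R * n%:R - m%:R * k%:R in
        Psi (m - 1)%N k =
          1 / (d + 1) * Num.max (k%:R / n%:R) (Psi m k)
          + k%:R * d / ((k%:R + 1) * (d + 1)) * Psi (m - 1)%N k.+1
          + d / ((k%:R + 1) * (d + 1)) * Psi 1%N k.+1
    & forall k i : nat, (1 <= k < n)%N -> (1 <= i <= m - 2)%N ->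
        let d := m%:R * n%:R - m%:R * k%:R in
        Psi i k =
          k%:R * d / ((k%:R + 1) * (d + m%:R - i%:R)) * Psi i k.+1
          + (m%:R - i%:R) / (d + m%:R - i%:R) * Psi i.+1 k
          + d / ((k%:R + 1) * (d + m%:R - i%:R)) * Psi 1%N k.+1].

(* Cost model: an imperative language whose only data are numbers, held in
   finitely many registers and in a two-dimensional table.  Each arithmetic
   operation and each comparison of two numbers costs 1, including those that
   evaluate coefficients, table indices, loop counters and loop guards; register
   and table accesses and natural-number literals are free. *)
Inductive reg := rm | rn | ri | rk | rd | rmax.

Definition eq_reg (x y : reg) : bool :=
  match x, y with
  | rm, rm | rn, rn | ri, ri | rk, rk | rd, rd | rmax, rmax => true
  | _, _ => false
  end.

Inductive binop := Add | Sub | Mul | Div.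

Inductive expr :=
| Lit of nat
| Reg of reg
| Cell of expr & expr
| Bin of binop & expr & expr.

Inductive cmd :=
| Assign of reg & expr
| Store of expr & expr & expr
| Seq of cmd & cmd
| WhenLe of expr & expr & cmd
| WhileLe of expr & expr & cmd.

Record state (R : realType) := State {
  regs : reg -> R;
  table : nat -> nat -> R
}.

Definition eval_binop (R : realType) (o : binop) (x y : R) : R :=
  match o with
  | Add => x + y
  | Sub => x - y
  | Mul => x * y
  | Div => x / y
  end.

(* [Num.truncn] only decodes a number into an address; the program below uses
   natural-number addresses exclusively. *)
Fixpoint eval_expr (R : realType) (s : state R) (e : expr) : R :=
  match e with
  | Lit c => c%:R
  | Reg x => regs s x
  | Cell e1 e2 =>
      table s (Num.truncn (eval_expr s e1)) (Num.truncn (eval_expr s e2))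
  | Bin o e1 e2 => eval_binop o (eval_expr s e1) (eval_expr s e2)
  end.

Fixpoint ops (e : expr) : nat :=
  match e with
  | Lit _ | Reg _ => 0%N
  | Cell e1 e2 => (ops e1 + ops e2)%N
  | Bin _ e1 e2 => (ops e1 + ops e2).+1
  end.

Definition set_reg (R : realType) (s : state R) (x : reg) (v : R) : state R :=
  State (fun y => if eq_reg y x then v else regs s y) (table s).

Definition set_cell (R : realType) (s : state R) (i k : nat) (v : R) : state R :=
  State (regs s)
        (fun i' k' => if (i' == i) && (k' == k) then v else table s i' k').

(* [exec c s t s']: from state [s] the command [c] terminates in state [s']
   after exactly [t] elementary operations. *)
Inductive exec (R : realType) : cmd -> state R -> nat -> state R -> Prop :=
| exec_assign x e s :
    exec (Assign x e) s (ops e) (set_reg s x (eval_expr s e))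
| exec_store e1 e2 e s :
    exec (Store e1 e2 e) s (ops e1 + ops e2 + ops e)%N
      (set_cell s (Num.truncn (eval_expr s e1)) (Num.truncn (eval_expr s e2))
         (eval_expr s e))
| exec_seq c1 c2 s1 s2 s3 t1 t2 :
    exec c1 s1 t1 s2 -> exec c2 s2 t2 s3 ->
    exec (Seq c1 c2) s1 (t1 + t2)%N s3
| exec_when_true e1 e2 c s s' t :
    eval_expr s e1 <= eval_expr s e2 -> exec c s t s' ->
    exec (WhenLe e1 e2 c) s (ops e1 + ops e2 + 1 + t)%N s'
| exec_when_false e1 e2 c s :
    ~~ (eval_expr s e1 <= eval_expr s e2) ->
    exec (WhenLe e1 e2 c) s (ops e1 + ops e2 + 1)%N s
| exec_while_true e1 e2 c s1 s2 s3 t1 t2 :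
    eval_expr s1 e1 <= eval_expr s1 e2 -> exec c s1 t1 s2 ->
    exec (WhileLe e1 e2 c) s2 t2 s3 ->
    exec (WhileLe e1 e2 c) s1 (ops e1 + ops e2 + 1 + t1 + t2)%N s3
| exec_while_false e1 e2 c s :
    ~~ (eval_expr s e1 <= eval_expr s e2) ->
    exec (WhileLe e1 e2 c) s (ops e1 + ops e2 + 1)%N s.

(* The final state and the number of operations are functions of the program
   and of the initial state, so a cost realised by [exec] is the cost. *)
Lemma exec_det (R : realType) (c : cmd) (s s1 s2 : state R) (t1 t2 : nat) :
  exec c s t1 s1 -> exec c s t2 s2 -> t1 = t2 /\ s1 = s2.
Proof.
move=> H; elim: H t2 s2 => {c s t1 s1}; intros;
  match goal with H : exec _ _ _ _ |- _ /\ _ = ?u =>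
    match type of H with exec _ _ _ u => inversion H; subst; clear H end
  end;
  repeat match goal with
  | le12 : is_true ?b, nle : is_true (~~ ?b) |- _ => by rewrite le12 in nle
  | IH : (forall t s, exec ?c ?u t s -> _), H : exec ?c ?u _ _ |- _ =>
      destruct (IH _ _ H); clear IH; subst
  end; by [].
Qed.

Declare Scope prog_scope.
Delimit Scope prog_scope with prog.
Bind Scope prog_scope with expr cmd.
Notation "a + b" := (Bin Add a b) : prog_scope.
Notation "a - b" := (Bin Sub a b) : prog_scope.
Notation "a * b" := (Bin Mul a b) : prog_scope.
Notation "a / b" := (Bin Div a b) : prog_scope.
Notation "c1 ;; c2" := (Seq c1 c2)
  (at level 100, c2 at level 200, right associativity,
   format "'[v' c1  ;; '/' c2 ']'") : prog_scope.
Coercion Lit : nat >-> expr.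
Coercion Reg : reg >-> expr.

Local Open Scope prog_scope.

Definition dp_terminal : cmd :=
  Store rm rn 0%N ;;
  Assign ri 1%N ;;
  WhileLe ri (rm - 1%N)
    (Store ri rn 1%N ;;
     Assign ri (ri + 1%N)).

(* Computes the values for the k held in [rk] from those for k + 1; [rd] holds
   mn - mk and [rmax] the maximum. *)
Definition dp_column : cmd :=
  Store rm rk
    (rk / (rk + 1%N) * Cell rm (rk + 1%N)
     + 1%N / (rk + 1%N) * Cell 1%N (rk + 1%N)) ;;
  Assign rd (rm * rn - rm * rk) ;;
  Assign rmax (rk / rn) ;;
  WhenLe rmax (Cell rm rk)
    (Assign rmax (Cell rm rk)) ;;
  Store (rm - 1%N) rk
    (1%N / (rd + 1%N) * rmax
     + rk * rd / ((rk + 1%N) * (rd + 1%N)) * Cell (rm - 1%N) (rk + 1%N)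
     + rd / ((rk + 1%N) * (rd + 1%N)) * Cell 1%N (rk + 1%N)) ;;
  Assign ri (rm - 2%N) ;;
  WhileLe 1%N ri
    (Store ri rk
       (rk * rd / ((rk + 1%N) * (rd + rm - ri)) * Cell ri (rk + 1%N)
        + (rm - ri) / (rd + rm - ri) * Cell (ri + 1%N) rk
        + rd / ((rk + 1%N) * (rd + rm - ri)) * Cell 1%N (rk + 1%N)) ;;
     Assign ri (ri - 1%N)).

Definition dynamic_program : cmd :=
  dp_terminal ;;
  Assign rk (rn - 1%N) ;;
  WhileLe 1%N rk
    (dp_column ;;
     Assign rk (rk - 1%N)).

Definition input_state (R : realType) (m n : nat) : state R :=
  State (fun x => match x with rm => m%:R | rn => n%:R | _ => 0%R end)
        (fun _ _ => 0%R).

(* Main.v *)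
Require Import Defs.
From mathcomp Require Import all_boot all_order all_algebra.
From mathcomp Require Import all_classical all_reals all_analysis.
From mathcomp Require Import zify.

Import Order.TTheory GRing.Theory Num.Theory.
Import numFieldNormedType.Exports.

Local Open Scope classical_set_scope.
Local Open Scope ring_scope.

(* The number of operations is an exact affine function of n: every branch of
   the program costs the same whichever way a comparison falls, so each loop
   costs its iteration count times a constant, and a column k costs a constant
   depending on m only. *)

(** The invariant [P] is indexed by the number of iterations still to run, so induction on it gives
    termination and the exact cost together. The summand outside the product is the last, failing
    guard test. *)
Lemma exec_while_count (R : realType) (e1 e2 : expr) (c : cmd) (t : nat)
    (P : nat -> state R -> Prop) (N : nat) :
  (forall s, P 0%N s -> ~~ (eval_expr s e1 <= eval_expr s e2)) ->
  (forall j s, (j < N)%N -> P j.+1 s ->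
     eval_expr s e1 <= eval_expr s e2 /\ exists2 s', exec c s t s' & P j s') ->
  forall s, P N s ->
  exists2 s', exec (WhileLe e1 e2 c) s
    (N * (ops e1 + ops e2 + 1 + t) + (ops e1 + ops e2 + 1))%N s' & P 0%N s'.
Proof.
move=> P0; elim: N => [|N IHN] PS s PN.
  by exists s => //; apply: exec_while_false; exact: P0.
have [le12 [s1 cs1 PN1]] := PS N s (ltnSn N) PN.
have [|s2 ws2 P2] := IHN _ s1 PN1; first by move=> j s0 /ltnW jN; exact: PS.
by exists s2 => //; rewrite mulSn -addnA; exact: exec_while_true ws2.
Qed.

Lemma exec_cost (R : realType) (c : cmd) (s s' : state R) (t t' : nat) :
  exec c s t s' -> t = t' -> exec c s t' s'.
Proof. by move=> + <-. Qed.

(** Assigning a free expression costs nothing, so both outcomes have one cost and the case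
    distinction moves into the final state. *)
Lemma exec_when_assign (R : realType) (e1 e2 e : expr) (x : reg) (s : state R) :
  ops e = 0%N ->
  exec (WhenLe e1 e2 (Assign x e)) s (ops e1 + ops e2 + 1)%N
    (if eval_expr s e1 <= eval_expr s e2 then set_reg s x (eval_expr s e)
     else s).
Proof.
move=> e0; case: ifPn => le12; last exact: exec_when_false.
by rewrite -[X in exec _ _ X _]addn0 -[X in (_ + X)%N]e0;
  exact: exec_when_true le12 (exec_assign _ _ _).
Qed.

(** This and the next definitions cut [secretary_recurrences] into single equations, so that loop
    invariants can collect them as cells are filled. *)
Definition terminal_spec {R : realType} (m n : nat) (T : nat -> nat -> R) :=
  T m n = 0 /\ (forall i : nat, (1 <= i <= m - 1)%N -> T i n = 1).

Definition top_spec {R : realType} (m n k : nat) (T : nat -> nat -> R) :=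
  T m k = k%:R / (k%:R + 1) * T m k.+1 + 1 / (k%:R + 1) * T 1%N k.+1.

Definition subtop_spec {R : realType} (m n k : nat) (T : nat -> nat -> R) :=
  let d := m%:R * n%:R - m%:R * k%:R in
  T (m - 1)%N k =
    1 / (d + 1) * Num.max (k%:R / n%:R) (T m k)
    + k%:R * d / ((k%:R + 1) * (d + 1)) * T (m - 1)%N k.+1
    + d / ((k%:R + 1) * (d + 1)) * T 1%N k.+1.

Definition inner_spec {R : realType} (m n k i : nat) (T : nat -> nat -> R) :=
  let d := m%:R * n%:R - m%:R * k%:R in
  T i k =
    k%:R * d / ((k%:R + 1) * (d + m%:R - i%:R)) * T i k.+1
    + (m%:R - i%:R) / (d + m%:R - i%:R) * T i.+1 k
    + d / ((k%:R + 1) * (d + m%:R - i%:R)) * T 1%N k.+1.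

Definition column_spec {R : realType} (m n k : nat) (T : nat -> nat -> R) :=
  [/\ top_spec m n k T, subtop_spec m n k T
    & forall i, (1 <= i <= m - 2)%N -> inner_spec m n k i T].

Definition sizes_in {R : realType} (m n : nat) (s : state R) :=
  regs s rm = m%:R /\ regs s rn = n%:R.

(** The equations at [k] read columns [k] and [k.+1] only, so they survive later writes to smaller
    columns. *)
Lemma column_spec_eq (R : realType) (m n k : nat) (T T' : nat -> nat -> R) :
  (forall i k', (k <= k')%N -> T' i k' = T i k') ->
  column_spec m n k T -> column_spec m n k T'.
Proof.
by move=> TT'; rewrite /column_spec /top_spec /subtop_spec /inner_spec;
  case=> *; split=> *; rewrite !TT' //; auto.
Qed.

Lemma exec_dp_terminal (R : realType) (m n : nat) (s : state R) :
  (2 <= m)%N -> sizes_in m n s ->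
  exists2 s', exec dp_terminal s ((m - 1) * 3 + 2)%N s' &
    sizes_in m n s' /\ terminal_spec m n (table s').
Proof.
move=> m2 [sm sn].
(* Rows below [m - j] are filled. Since [ri] is less than [m] at every store, the 0 in row [m] is
   kept. *)
pose P j (s : state R) := [/\ (j < m)%N, sizes_in m n s, regs s ri = (m - j)%:R,
  table s m n = 0 & forall i, (1 <= i < m - j)%N -> table s i n = 1].
set s1 := set_cell s m n 0.
set s2 := set_reg s1 ri 1.
have [|||s3 w3 [_ sz3 _ T3 T3']] := @exec_while_count R ri (rm - 1%N)%prog
  (Store ri rn 1%N ;; Assign ri (ri + 1%N))%prog 1 P (m - 1)%N _ _ s2.
- move=> s0 [_ [s0m s0n] s0i _ _] /=.
  by rewrite s0m s0i subn0 -natrB ?ler_nat; lia.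
- move=> j s0 jm [jm' [s0m s0n] s0i T0 T0'] /=; split.
    by rewrite s0m s0i -natrB ?ler_nat; lia.
  eexists.
    exact: (exec_seq (exec_store _ _ _ _) (exec_assign _ _ _)).
  split=> //=; first lia.
  + by rewrite s0i natr1; congr _%:R; lia.
  + rewrite s0i s0n !natrK T0; case: ifP => // /andP[/eqP]; lia.
  + move=> i ilt; rewrite s0i s0n !natrK eqxx andbT.
    by case: eqVneq => // ne; apply: T0'; lia.
- split=> //=; first lia.
  + by have -> : (m - (m - 1) = 1)%N by lia.
  + by rewrite !eqxx.
  + by move=> i; lia.
exists s3; last first.
  by split=> //; split=> // i im; apply: T3'; lia.
have w1 : exec (Store rm rn 0%N) s 0 s1.
  by have := exec_store rm rn 0%N s; rewrite /= sm sn !natrK.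
by have := exec_seq w1 (exec_seq (exec_assign ri 1%N s1) w3).
Qed.

(** Row [m], [rd] and the maximum take 14 operations, row [m - 1] and the loop counter 21, each of
    the other [m - 2] rows 25 with its guard, and the failing guard 1. *)
Lemma exec_dp_column (R : realType) (m n k : nat) (s : state R) :
  (2 <= m)%N -> sizes_in m n s -> regs s rk = k%:R ->
  exists2 s', exec dp_column s (36 + (m - 2) * 25)%N s' &
    [/\ sizes_in m n s', regs s' rk = k%:R, column_spec m n k (table s')
      & forall i k', k' != k -> table s' i k' = table s i k'].
Proof.
move=> m2 [sm sn] sk.
have kS : (k.+1 == k) = false by lia.
pose d : R := m%:R * n%:R - m%:R * k%:R.
pose ready (s' : state R) :=
  [/\ sizes_in m n s' /\ regs s' rk = k%:R, regs s' rd = d,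
    top_spec m n k (table s')
    & forall i k', k' != k -> table s' i k' = table s i k'].
(* Sequencing associates to the right, so this prefix is not a subterm of [dp_column]; its execution
   is stated for an arbitrary continuation [c]. *)
have [s1 [w1 [[[s1m s1n] s1k] s1d T1 F1] max1]] : exists s1, [/\
    forall c t s', exec c s1 t s' -> exec
      (Store rm rk
        (rk / (rk + 1%N) * Cell rm (rk + 1%N)
         + 1%N / (rk + 1%N) * Cell 1%N (rk + 1%N)) ;;
      Assign rd (rm * rn - rm * rk) ;;
      Assign rmax (rk / rn) ;;
      WhenLe rmax (Cell rm rk)
        (Assign rmax (Cell rm rk)) ;; c)%prog s (14 + t)%N s',
    ready s1 & regs s1 rmax = Num.max (k%:R / n%:R) (table s1 m k)].
  eexists; split.
  - move=> c t s' w.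
    eapply exec_cost.
      exact (exec_seq (exec_store _ _ _ _) (exec_seq (exec_assign _ _ _)
        (exec_seq (exec_assign _ _ _)
        (exec_seq (exec_when_assign _ _ _ (Cell rm rk) _ _ erefl) w)))).
    by [].
  - rewrite /= !sm !sn !sk !natr1 !natrK !eqxx /=.
    by case: ifP => _; split=> //= *; rewrite /top_spec /= ?natr1 ?eqxx ?kS
      ?andbF //; case: ifP => // /andP[_ /eqP]; lia.
  - rewrite /= !sm !sn !sk !natr1 !natrK !eqxx /=.
    by case: ifPn => /= [le|]; rewrite !eqxx /=; [rewrite max_r|
      rewrite -ltNge => /ltW ?; rewrite max_l].
have [s2 [w2 [[[s2m s2n] s2k] s2d T2 F2] S2 s2i]] : exists s2, [/\
    forall c t s', exec c s2 t s' -> exec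
      (Store (rm - 1%N) rk
        (1%N / (rd + 1%N) * rmax
         + rk * rd / ((rk + 1%N) * (rd + 1%N)) * Cell (rm - 1%N) (rk + 1%N)
         + rd / ((rk + 1%N) * (rd + 1%N)) * Cell 1%N (rk + 1%N)) ;;
       Assign ri (rm - 2%N) ;; c)%prog s1 (21 + t)%N s',
    ready s2, subtop_spec m n k (table s2) & regs s2 ri = (m - 2)%:R].
  eexists; split.
  - move=> c t s' w.
    eapply exec_cost.
      exact (exec_seq (exec_store _ _ _ _) (exec_seq (exec_assign _ _ _) w)).
    by [].
  - have mB1 : m%:R - 1 = (m - 1)%:R :> R by rewrite natrB //; lia.
    rewrite /= !s1m !s1k !s1d !mB1 !natr1 !natrK /=.
    split=> //=.
      rewrite /top_spec /= kS eqxx !andbF !andbT.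
      by case: eqVneq => [|_]; [lia|exact: T1].
    move=> i k' k'k; rewrite (negbTE k'k) andbF; exact: F1.
  - have mB1 : m%:R - 1 = (m - 1)%:R :> R by rewrite natrB //; lia.
    rewrite /= !s1m !s1k !s1d !mB1 !natr1 !natrK /subtop_spec /=.
    rewrite !eqxx kS !andbF !andbT max1 natr1.
    by have -> : (m == m - 1)%N = false by lia.
  - by rewrite /= s1m natrB.
(* Rows are filled downwards because row [i] reads row [i.+1] of the same column. The bound on [j]
   keeps the stores away from rows [m - 1] and [m]. *)
pose P j (s' : state R) := [/\ ready s', subtop_spec m n k (table s'),
  regs s' ri = j%:R, (j <= m - 2)%N
  & forall i, (j < i <= m - 2)%N -> inner_spec m n k i (table s')].
have [|||s3 w3 [[[sz3 s3k] _ T3 F3] S3 _ _ I3]] :=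
  @exec_while_count R 1%N ri
    (Store ri rk
       (rk * rd / ((rk + 1%N) * (rd + rm - ri)) * Cell ri (rk + 1%N)
        + (rm - ri) / (rd + rm - ri) * Cell (ri + 1%N) rk
        + rd / ((rk + 1%N) * (rd + rm - ri)) * Cell 1%N (rk + 1%N)) ;;
     Assign ri (ri - 1%N))%prog 24 P (m - 2)%N _ _ s2.
- by move=> s0 [_ _ s0i _ _] /=; rewrite s0i ler_nat.
- move=> j s0 jm [[[[s0m s0n] s0k] s0d T0 F0] S0 s0i _ I0] /=.
  rewrite s0i ler_nat; split=> //; eexists.
    eapply exec_cost.
      exact (exec_seq (exec_store _ _ _ _) (exec_assign _ _ _)).
    by [].
  rewrite /= !s0m !s0k !s0d !s0i !natr1 !natrK.
  have jB1 : j.+1%:R - 1 = j%:R :> R by rewrite -natr1 addrK.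
  split=> //=.
  + split=> //=.
      rewrite /top_spec /= kS eqxx !andbF !andbT.
      by case: eqVneq => [|_]; [lia|exact: T0].
    move=> i k' k'k; rewrite (negbTE k'k) andbF; exact: F0.
  + rewrite /subtop_spec /= kS eqxx !andbF !andbT.
    by do 2![case: eqVneq => [|_]; first lia]; exact: S0.
  + lia.
  (* Either [i] is the row just stored, or it lies above it and its equation reads no modified
     cell. *)
  + move=> i ij; rewrite /inner_spec /= kS eqxx !andbF !andbT.
    have -> : (i.+1 == j.+1) = false by lia.
    case: eqVneq => [->|ne]; first by rewrite natr1.
    by apply: I0; lia.
- by split=> // i; lia.
exists s3; first by apply: exec_cost (w1 _ _ _ (w2 _ _ _ w3)) _ => /=; lia.
by split=> //; split=> // i im; apply: I3; lia.
Qed.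

Theorem proposition8 (R : realType) (m : nat) (hm : (2 <= m)%N) :
  exists cost : nat -> nat,
    (forall n : nat, (1 <= n)%N ->
       exists s : state R,
         exec dynamic_program (input_state R m n) (cost n) s /\
         secretary_recurrences m n (table s)) /\
    (fun n : nat => (cost n)%:R : R) =O_\oo (fun n : nat => n%:R : R).
Proof.
(* [c] is a column plus the decrement of [rk], and [c.+1] adds the guard. [b] is the terminal phase,
   the initial [rn - 1] and the failing guard. *)
pose c := (36 + (m - 2) * 25 + 1)%N; pose b := ((m - 1) * 3 + 4)%N.
exists (fun n => (b + (n - 1) * c.+1)%N); split; last first.
  (* For [n] at least 1, [b] is at most [b * n], and [n - 1] is at most [n]. *)
  apply/eqO_exP; exists (b + c.+1)%:R; first by rewrite ltr0n addnS.
  near=> n; rewrite !normr_nat -natrM ler_nat.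
  have n1 : (1 <= n)%N by near: n; exact: nbhs_infty_ge.
  by rewrite mulnDl leq_add ?leq_pmulr // mulnC leq_mul2l leq_subr orbT.
move=> n n1.
have [//|s1 w1 [[s1m s1n] [T1 T1']]] :=
  @exec_dp_terminal R m n (input_state R m n) hm.
(* Columns [j.+1] to [n - 1] are done. As [j] stays below [n], the terminal column is never
   overwritten. *)
pose P j (s : state R) := [/\ sizes_in m n s, regs s rk = j%:R, (j < n)%N,
  terminal_spec m n (table s)
  & forall k, (j < k < n)%N -> column_spec m n k (table s)].
have [|||s2 w2 [_ _ _ [T2 T2'] C2]] := @exec_while_count R 1%N rk
  (dp_column ;; Assign rk (rk - 1%N))%prog c P (n - 1)%N _ _
  (set_reg s1 rk (n - 1)%:R).
- by move=> s [_ sk _ _ _] /=; rewrite sk ler_nat.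
- move=> j s _ [sz sk jn [T0 T0'] C] /=; rewrite sk ler_nat; split=> //.
  have [s' w' [sz' sk' C' F]] := exec_dp_column _ _ _ _ _ hm sz sk.
  eexists.
    exact (exec_seq w' (exec_assign _ _ _)).
  split=> //=; first by rewrite sk' -natr1 addrK.
  + lia.
  + by split=> [|i im]; rewrite F ?T0 ?T0' //; lia.
  + move=> k kn; have [->//|kj] := eqVneq k j.+1.
    apply: column_spec_eq (C k _); last lia.
    by move=> i k' kk'; apply: F; lia.
- split=> //=; first lia.
  by move=> k; lia.
(* The program subtracts in [R], the invariant in [nat]; the two agree because [n] is at least 1. *)
have rk1 : set_reg s1 rk (eval_expr s1 (rn - 1%N)%prog) =
    set_reg s1 rk (n - 1)%:R by rewrite /= s1n natrB.
rewrite -rk1 in w2; exists s2; split.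
  apply: exec_cost (exec_seq w1 (exec_seq (exec_assign _ _ _) w2)) _.
  rewrite /b /=; lia.
by split=> [|k kn|k kn|k i kn im] //; have [? ? I] := C2 k kn => //; exact: I.
Unshelve. all: by end_near.
Qed.
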